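(* A commutative ring $A$ is a point for the $(Hens^o,indEt^o)$ factorisation system on $CRings^o$ if and only if it is a nilpotent extension of a separably closed field, i.e. there is a surjective ring map from $A$ onto a separably closed field all of whose kernel elements are nilpotent.
   Context: $CRings$ is the category of commutative unital rings. $Et^f$ is the class of etale ring maps (flat and unramified) of finite presentation and $Et^f_*$ the class of etale maps between rings of finite presentation over $\mathbb{Z}$. $Hens$, the class of henselian maps, is the class of ring maps having the unique right lifting property with respect to $Et^f_*$. $indEt$ is the class of maps having the unique left lifting property with respect to $Hens$; it is the class of filtered colimits (in the category of arrows) of maps in $Et^f$, and $(indEt,Hens)$ is a unique factorisation system on $CRings$ (left class $indEt$), viewed as $(Hens^o,indEt^o)$ on the opposite category. The maps of finite presentation in $indEt$ are those of $Et^f$. A ring $A$ is a point of this system if $A\ne0$ and every map $A\to B$ in $Et^f$ with $B\neq 0$ admits a retraction $B\to A$. *)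

(* Defs.v *)
(* All rings are possibly-zero commutative rings
   (comPzRingType); objects absent from the library (polynomial rings, tensor
   products, Kaehler differentials) are given by their universal properties. *)
From HB Require Import structures.
From mathcomp Require Import all_boot all_order all_algebra all_field.
Set Implicit Arguments.
Unset Strict Implicit.
Unset Printing Implicit Defensive.
Import GRing.Theory.
Local Open Scope ring_scope.

(* B as an A-module through f, i.e. a *: b = f a * b. *)
Definition restr_scalars (A B : comPzRingType) (f : {rmorphism A -> B}) : Type := B.

Section RestrScalars.
Variables (A B : comPzRingType) (f : {rmorphism A -> B}).

HB.instance Definition _ := GRing.Zmodule.on (restr_scalars f).

Definition restr_scale (a : A) (b : restr_scalars f) : restr_scalars f :=
  f a * (b : B).

Fact restr_scaleA (a b : A) (x : restr_scalars f) :
  restr_scale a (restr_scale b x) = restr_scale (a * b) x.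
Proof. by rewrite /restr_scale rmorphM mulrA. Qed.

Fact restr_scale1 : left_id 1 restr_scale.
Proof. by move=> x; rewrite /restr_scale rmorph1 mul1r. Qed.

Fact restr_scaleDr : right_distributive restr_scale +%R.
Proof. by move=> a x y; rewrite /restr_scale [LHS]mulrDr. Qed.

Fact restr_scaleDl (x : restr_scalars f) :
  {morph restr_scale^~ x : a b / a + b}.
Proof. by move=> a b; rewrite /restr_scale rmorphD [LHS]mulrDl. Qed.

HB.instance Definition _ :=
  GRing.Zmodule_isLmodule.Build A (restr_scalars f)
    restr_scaleA restr_scale1 restr_scaleDr restr_scaleDl.

End RestrScalars.

Definition is_bilinear (A : comPzRingType) (M N P : lmodType A)
    (t : M -> N -> P) : Prop :=
  (forall n, linear (t^~ n)) /\ (forall m, linear (t m)).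

Definition is_tensor (A : comPzRingType) (M N T : lmodType A)
    (t : M -> N -> T) : Prop :=
  is_bilinear t /\
  forall (P : lmodType A) (b : M -> N -> P), is_bilinear b ->
    exists2 g : {linear T -> P},
      forall m n, g (t m n) = b m n &
      forall g' : {linear T -> P}, (forall m n, g' (t m n) = b m n) -> g' =1 g.

(* - (x) N preserves injections; v below is u (x) N. *)
Definition flat_module (A : comPzRingType) (N : lmodType A) : Prop :=
  forall (M M' : lmodType A) (u : {linear M -> M'}), injective u ->
  forall (T T' : lmodType A) (t : M -> N -> T) (t' : M' -> N -> T'),
    is_tensor t -> is_tensor t' ->
  forall v : {linear T -> T'},
    (forall m n, v (t m n) = t' (u m) n) -> injective v.

Definition flat (A B : comPzRingType) (f : {rmorphism A -> B}) : Prop :=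
  flat_module (restr_scalars f).

Definition is_derivation (A B : comPzRingType) (f : {rmorphism A -> B})
    (M : lmodType B) (d : B -> M) : Prop :=
  [/\ forall x y, d (x + y) = d x + d y,
      forall x y, d (x * y) = x *: d y + y *: d x
    & forall a, d (f a) = 0].

Definition is_kahler (A B : comPzRingType) (f : {rmorphism A -> B})
    (Om : lmodType B) (d : B -> Om) : Prop :=
  is_derivation f d /\
  forall (M : lmodType B) (D : B -> M), is_derivation f D ->
    exists2 h : {linear Om -> M},
      forall x, h (d x) = D x &
      forall h' : {linear Om -> M}, (forall x, h' (d x) = D x) -> h' =1 h.

(* Omega_{B/A} = 0; finite type is left to finite presentation below. *)
Definition unramified (A B : comPzRingType) (f : {rmorphism A -> B}) : Prop :=
  exists (Om : lmodType B) (d : B -> Om),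
    is_kahler f d /\ forall w : Om, w = 0.

(* P, with structure map c, is the polynomial A-algebra on the variables x;
   the library's {mpoly A[n]} is only available over nonzero A. *)
Definition is_polynomial_algebra (A : comPzRingType) (n : nat)
    (P : comPzRingType) (c : {rmorphism A -> P}) (x : 'I_n -> P) : Prop :=
  forall (C : comPzRingType) (g : {rmorphism A -> C}) (y : 'I_n -> C),
    exists2 h : {rmorphism P -> C},
      (forall a, h (c a) = g a) /\ (forall i, h (x i) = y i) &
      forall h' : {rmorphism P -> C},
        (forall a, h' (c a) = g a) -> (forall i, h' (x i) = y i) -> h' =1 h.

(* B is A[x_1, ..., x_n] / (r_1, ..., r_m) as an A-algebra. *)
Definition finite_presentation (A B : comPzRingType) (f : {rmorphism A -> B}) :
    Prop :=
  exists (n : nat) (P : comPzRingType) (c : {rmorphism A -> P}) (x : 'I_n -> P),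
    is_polynomial_algebra c x /\
  exists q : {rmorphism P -> B},
    [/\ forall a, q (c a) = f a,
        forall b, exists p, q p = b
      & exists (m : nat) (r : 'I_m -> P), forall p,
          q p = 0 <-> exists s : 'I_m -> P, p = \sum_(j < m) s j * r j].

Definition etale (A B : comPzRingType) (f : {rmorphism A -> B}) : Prop :=
  flat f /\ unramified f.

Definition Etf (A B : comPzRingType) (f : {rmorphism A -> B}) : Prop :=
  etale f /\ finite_presentation f.

(* Points of the (Hens^o, indEt^o) factorisation system on CRings^o. *)
Definition is_point (A : comPzRingType) : Prop :=
  (1 : A) <> 0 /\
  forall (B : comPzRingType) (f : {rmorphism A -> B}),
    Etf f -> (1 : B) <> 0 -> exists g : {rmorphism B -> A}, cancel f g.

Definition separably_closed (K : fieldType) : Prop :=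
  forall p : {poly K}, separable_poly p -> (1 < size p)%N ->
    exists x : K, root p x.

Definition nilpotent_extension (A K : comPzRingType) (p : {rmorphism A -> K}) :
    Prop :=
  (forall y, exists x, p x = y) /\
  (forall x, p x = 0 -> exists n : nat, x ^+ n = 0).

(* Main.v *)
Require Import Defs.
From HB Require Import structures.
From mathcomp Require Import all_boot all_order all_algebra all_field.
From mathcomp Require Import boolp classical_sets functions.
From mathcomp Require Import ring zify.

(** A point is tested only against the simple extensions A[X]/(r): when such an
    extension is nonzero, flat and makes r' invertible, it is etale of finite
    presentation, and a retraction is exactly a root of r in A ([point_root]).
    Taking r = aX - 1, whose extension is the localisation at a, shows that
    every element of A is nilpotent or invertible, so the nilradical is
    maximal. Taking for r a monic lift of a separable polynomial over the
    residue field shows that this field is separably closed: the Bezout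
    relation between the polynomial and its derivative lifts up to a nilpotent
    error, which keeps r' invertible modulo r.

    Conversely let A -> K be a nilpotent extension with K separably closed, and
    f : A -> B a nonzero etale map. Two things have to be found.

    A K-point of B ([unramified_point]). Let L be a residue field of B at a
    maximal ideal. It is generated over K by finitely many elements and, as B
    is unramified, has no nonzero K-derivation. Adjoin the generators one at a
    time. If the last one were not separable over the ring below it, then d/dx
    would be a nonzero derivation; as it is separable, every derivation of the
    ring below extends, so that there is none on that ring either. Going
    downwards all generators are separable over K, hence lie in K, and L = K
    ([tower_without_derivation]).

    A lift of that point phi to A ([etale_point_retraction]). Let N be the
    kernel of A -> K and m that of phi. The map sending b to b minus a lift of
    phi b is a derivation modulo NB + m^2, so m = NB + m^2, and since m is
    finitely generated modulo NB the determinant trick yields g with phi g = 1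
    and g m contained in NB. As g (1 - g) is nilpotent, an idempotent e can be
    built from g; then eB = Ae + (finitely many nilpotents of A) eB, hence
    eB = Ae by Nakayama. Flatness makes e free: if a e = 0, then e lies in
    Ann(a) B, and for a <> 0 this ideal consists of nilpotents. So eB is a copy
    of A, and b |-> e b is the retraction. *)

Set Implicit Arguments.
Unset Strict Implicit.
Unset Printing Implicit Defensive.
Import GRing.Theory Pdiv.CommonRing Pdiv.RingMonic.
Local Open Scope ring_scope.

(** * Quotients *)

(** Quotients are used only through a surjection with a prescribed kernel, so
    that the choice of representatives stays inside these proofs. *)
Lemma quotient_zmod (V : zmodType) (S : V -> Prop) :
  S 0 -> (forall x y, S x -> S y -> S (x - y)) ->
  exists (I : zmodClosed V) (pi : {additive V -> {ideal_quot I}}),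
    (forall y, exists x, pi x = y) /\ (forall x, pi x = 0 <-> S x).
Proof.
move=> S0 SB; pose s : pred V := fun x => `[< S x >].
have cs : zmod_closed s.
  by split=> [|x y /asboolP Sx /asboolP Sy]; apply/asboolP; [|apply: SB].
pose I : zmodClosed V := HB.pack s (GRing.isZmodClosed.Build V s cs).
exists I, \pi_{ideal_quot I}%qT; split=> [y|x].
  by exists (repr y); exact: reprK.
have sE : (S x : Prop) <-> x - 0 \in I by rewrite subr0; split=> /asboolP.
have pi0 : \pi_{ideal_quot I}%qT 0 = 0 := raddf0 _.
rewrite sE Quotient.idealrBE -pi0.
by split=> /eqP.
Qed.

Lemma quotient_module (A : comPzRingType) (V : lmodType A) (S : V -> Prop) :
  S 0 -> (forall x y, S x -> S y -> S (x + y)) ->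
  (forall a x, S x -> S (a *: x)) ->
  exists (Q : lmodType A) (pi : {linear V -> Q}),
    (forall y, exists x, pi x = y) /\ (forall x, pi x = 0 <-> S x).
Proof.
move=> S0 SD SZ.
have SB x y : S x -> S y -> S (x - y).
  by move=> Sx Sy; rewrite -scaleN1r; apply: SD => //; apply: SZ.
have [J [pi [pi_surj pi_ker]]] := quotient_zmod S0 SB.
pose Q := {ideal_quot J}.
have [s sK] := choice pi_surj.
have piE x y : S (x - y) -> pi x = pi y.
  by move=> Sxy; apply/eqP; rewrite -subr_eq0 -raddfB; apply/eqP/pi_ker.
pose sc a q := pi (a *: s q).
have scE a x : sc a (pi x) = pi (a *: x).
  by apply: piE; rewrite -scalerBr; apply/SZ/pi_ker; rewrite raddfB /= sK subrr.
have scA a b q : sc a (sc b q) = sc (a * b) q.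
  by rewrite -(sK q) !scE scalerA.
have sc1 : left_id 1 sc by move=> q; rewrite -(sK q) scE scale1r.
have scDr : right_distributive sc +%R.
  by move=> a q q'; rewrite -(sK q) -(sK q') -raddfD !scE scalerDr raddfD.
have scDl q : {morph sc^~ q : a b / a + b}.
  by move=> a b; rewrite /= -(sK q) !scE scalerDl raddfD.
pose Q_lmod := GRing.Zmodule_isLmodule.Build A Q scA sc1 scDr scDl.
pose Q' : lmodType A := HB.pack Q Q_lmod.
have piZ : scalable (pi : V -> Q').
  by move=> a x; rewrite -[RHS]/(sc a (pi x)) scE.
have piB : zmod_morphism (pi : V -> Q') by exact: raddfB.
pose pi' : {linear V -> Q'} := HB.pack (pi : V -> Q')
  (GRing.isZmodMorphism.Build V Q' (pi : V -> Q') piB)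
  (GRing.isScalable.Build A V Q' *:%R (pi : V -> Q') piZ).
by exists Q', pi'.
Qed.

Definition is_ideal (R : comPzRingType) (I : R -> Prop) :=
  [/\ I 0, forall x y, I x -> I y -> I (x + y) & forall a x, I x -> I (a * x)].

Lemma quotient_ring (R : comPzRingType) (I : R -> Prop) :
  is_ideal I ->
  exists (Q : comPzRingType) (pi : {rmorphism R -> Q}),
    (forall y, exists x, pi x = y) /\ (forall x, pi x = 0 <-> I x).
Proof.
move=> [I0 ID IM].
have IB x y : I x -> I y -> I (x - y).
  by move=> Ix Iy; rewrite -mulN1r; apply: ID => //; apply: IM.
have [J [pi [pi_surj pi_ker]]] := quotient_zmod I0 IB.
pose Q := {ideal_quot J}.
have [s sK] := choice pi_surj.
have piE x y : I (x - y) -> pi x = pi y.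
  by move=> Ixy; apply/eqP; rewrite -subr_eq0 -raddfB; apply/eqP/pi_ker.
pose mu q q' := pi (s q * s q').
have muE x y : mu (pi x) (pi y) = pi (x * y).
  apply: piE; rewrite -(subrK (s (pi x) * y) (_ * s _)) -mulrBr -addrA -mulrBl.
  apply: ID; first by apply/IM/pi_ker; rewrite raddfB /= sK subrr.
  by rewrite mulrC; apply/IM/pi_ker; rewrite raddfB /= sK subrr.
have muA : associative mu.
  by move=> x y z; rewrite -(sK x) -(sK y) -(sK z) !muE mulrA.
have muC : commutative mu.
  by move=> x y; rewrite -(sK x) -(sK y) !muE mulrC.
have mu1 : left_id (pi 1) mu.
  by move=> x; rewrite -(sK x) !muE mul1r.
have muD : left_distributive mu +%R.
  by move=> x y z; rewrite -(sK x) -(sK y) -(sK z) -raddfD !muE mulrDl raddfD.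
pose Q_ring := GRing.Zmodule_isComPzRing.Build Q muA muC mu1 muD.
pose Q' : comPzRingType := HB.pack Q Q_ring.
have piB : zmod_morphism (pi : R -> Q') by exact: raddfB.
have piM : monoid_morphism (pi : R -> Q').
  by split=> // x y; rewrite -[RHS]/(mu _ _) muE.
pose pi' : {rmorphism R -> Q'} := HB.pack (pi : R -> Q')
  (GRing.isZmodMorphism.Build R Q' (pi : R -> Q') piB)
  (GRing.isMonoidMorphism.Build R Q' (pi : R -> Q') piM).
by exists Q', pi'.
Qed.

Lemma quotient_field (R : comPzRingType) (I : R -> Prop) :
  is_ideal I -> ~ I 1 -> (forall x, ~ I x -> exists y, I (y * x - 1)) ->
  exists (F : fieldType) (pi : {rmorphism R -> F}),
    (forall y, exists x, pi x = y) /\ (forall x, pi x = 0 <-> I x).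
Proof.
move=> idI I1 Iinv.
have [Q [pi [pi_surj pi_ker]]] := quotient_ring idI.
have Q1 : (1 : Q) != 0.
  by apply/eqP; rewrite -(rmorph1 pi) => /pi_ker.
have Qinv (x : Q) : exists y, (x != 0 -> y * x = 1) /\ (x = 0 -> y = 0).
  have [->|x0] := eqVneq x 0; first by exists 0; split.
  have [z zx] := pi_surj x.
  have [/pi_ker Iz|/Iinv[y /pi_ker]] := pselect (I z).
    by rewrite -zx Iz eqxx in x0.
  rewrite rmorphB rmorphM rmorph1 zx => /eqP; rewrite subr_eq0 => /eqP yx.
  by exists (pi y); split=> // x1; rewrite x1 eqxx in x0.
have [inv invP] := choice Qinv.
pose Q_nz := GRing.PzSemiRing_isNonZero.Build Q Q1.
pose Q' : comNzRingType := HB.pack Q Q_nz.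
pose Q_field := GRing.ComNzRing_isField.Build Q' 
  (fun x => (invP x).1) ((invP 0).2 erefl).
pose F : fieldType := HB.pack Q' Q_field.
by exists F, pi.
Qed.

(** * Bilinear maps, tensor products and flatness *)

Section Bilinear.
Variables (A : comPzRingType) (M N P : lmodType A) (t : M -> N -> P).
Hypothesis t_bil : is_bilinear t.

Lemma bilinDl m m' n : t (m + m') n = t m n + t m' n.
Proof. by rewrite -{1}[m]scale1r (t_bil.1 n) scale1r. Qed.

Lemma bilinDr m n n' : t m (n + n') = t m n + t m n'.
Proof. by rewrite -{1}[n]scale1r (t_bil.2 m) scale1r. Qed.

Lemma bilin0l n : t 0 n = 0.
Proof. by apply: (addrI (t 0 n)); rewrite -bilinDl !addr0. Qed.

Lemma bilin0r m : t m 0 = 0.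
Proof. by apply: (addrI (t m 0)); rewrite -bilinDr !addr0. Qed.

Lemma bilinZl a m n : t (a *: m) n = a *: t m n.
Proof. by rewrite -[a *: m]addr0 (t_bil.1 n) bilin0l addr0. Qed.

Lemma bilinZr a m n : t m (a *: n) = a *: t m n.
Proof. by rewrite -[a *: n]addr0 (t_bil.2 m) bilin0r addr0. Qed.

Lemma bilin_sumr I (r : seq I) (F : I -> N) m :
  t m (\sum_(i <- r) F i) = \sum_(i <- r) t m (F i).
Proof. by apply: (big_morph (t m) (bilinDr m) (bilin0r m)). Qed.

End Bilinear.

(** The quotient of the tensor product by the submodule W receives two linear
    maps that vanish on pure tensors, the projection and 0; by uniqueness they
    agree. *)
Lemma tensor_span (A : comPzRingType) (M N T : lmodType A) (t : M -> N -> T)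
    (W : T -> Prop) :
  is_tensor t -> W 0 -> (forall x y, W x -> W y -> W (x + y)) ->
  (forall a x, W x -> W (a *: x)) -> (forall m n, W (t m n)) ->
  forall z, W z.
Proof.
move=> [t_bil t_univ] W0 WD WZ Wt z.
have [Q [pi [_ pi_ker]]] := quotient_module W0 WD WZ.
have zero_bil : is_bilinear (fun (_ : M) (_ : N) => 0 : Q).
  by split=> ? a ? ?; rewrite scaler0 addr0.
have [g _ g_uniq] := t_univ Q _ zero_bil.
apply/pi_ker; rewrite (g_uniq pi) => [|m n]; last exact/pi_ker.
by rewrite -(g_uniq (\0 : {linear T -> Q})).
Qed.

Lemma unramified_derivation0 (A B : comPzRingType) (f : {rmorphism A -> B})
    (M : lmodType B) (D : B -> M) :
  unramified f -> is_derivation f D -> forall b, D b = 0.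
Proof.
move=> [Om [d [[_ d_univ] Om0]]] D_der b.
by have [h <- _] := d_univ M D D_der; rewrite (Om0 (d b)) raddf0.
Qed.

(** B is the localisation A[1/a], described by its fractions c / a^j and its
    torsion. Every element of the tensor product of M and B is a pure tensor
    m (x) i^j. To see that it vanishes only if some a^k kills m, it is tested
    against the sequences in M' modulo eventual equality, where m (x) c / a^j
    is the sequence a^(k - j) c m: there a acts invertibly on the image without
    any localised module having to be built. *)
Lemma flat_localization (A B : comPzRingType) (f : {rmorphism A -> B})
    (a : A) (i : B) :
  f a * i = 1 -> (forall b, exists c j, b = f c * i ^+ j) ->
  (forall c, f c = 0 -> exists k, a ^+ k * c = 0) -> flat f.
Proof.
move=> ai Bfrac f_ker M M' u u_inj T T' t t' t_tens t'_tens v vE.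
have aik k : f (a ^+ k) * i ^+ k = 1 by rewrite rmorphXn -exprMn ai expr1n.
have fracM c j k : f c * i ^+ j = f (a ^+ k * c) * i ^+ (j + k).
  by rewrite -[LHS]mul1r -(aik k) rmorphM exprD; ring.
(* Two fractions are equal only if the numerators agree after multiplication
   by a power of a, hence for all large exponents k. *)
have frac_eq c j c' j' : f c * i ^+ j = f c' * i ^+ j' ->
    exists K, forall k, (K <= k)%N -> a ^+ (k - j) * c = a ^+ (k - j') * c'.
  move=> eq_frac.
  have /f_ker[s sP] : f (a ^+ j' * c - a ^+ j * c') = 0.
    have fE x : f x = f (a ^+ (j + j')) * (f x * i ^+ (j + j')).
      by rewrite mulrCA aik mulr1.
    by rewrite rmorphB fE (fE (a ^+ j * c')) -fracM eq_frac (fracM c' j' j)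
       [(j' + j)%N]addnC subrr.
  exists (s + (j + j'))%N => k le_k.
  have [l ->] : exists l, k = (l + (s + (j + j')))%N.
    by exists (k - (s + (j + j')))%N; rewrite subnK.
  have -> : (l + (s + (j + j')) - j = l + s + j')%N.
    by rewrite [(j + j')%N]addnC !addnA addnK.
  have -> : (l + (s + (j + j')) - j' = l + s + j)%N by rewrite !addnA addnK.
  apply/eqP; rewrite -subr_eq0 !exprD -!mulrA -!mulrBr.
  by rewrite sP mulr0.
(* Sequences that vanish eventually: the kernel of the test module. *)
pose ev0 (s : nat -> M') := exists K, forall k, (K <= k)%N -> s k = 0.
have [Q [pi [_ pi_ker]]] : exists (Q : lmodType A) (pi : {linear (nat -> M') -> Q}),
    (forall y, exists x, pi x = y) /\ (forall x, pi x = 0 <-> ev0 x).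
  apply: quotient_module => [|s s' [K sK] [K' sK']|b s [K sK]]; first by exists 0%N.
    exists (maxn K K') => k; rewrite geq_max => /andP[leK leK'].
    by rewrite addrfctE sK // sK' // addr0.
  by exists K => k leK; rewrite scalrfctE sK // scaler0.
have piP s s' : (exists K, forall k, (K <= k)%N -> s k = s' k) -> pi s = pi s'.
  move=> [K sK]; apply/eqP; rewrite -subr_eq0 -raddfB; apply/eqP/pi_ker.
  by exists K => k /sK; rewrite addrfctE opprfctE /= => ->; rewrite subrr.
have [num numP] := choice Bfrac.
have [den {}numP] := choice numP.
pose seqof (m : M') (c : A) (j : nat) : nat -> M' := fun k => (a ^+ (k - j) * c) *: m.
pose beta (m : M') (b : restr_scalars f) := pi (seqof m (num b) (den b)).
have betaE m b c j : b = f c * i ^+ j -> beta m b = pi (seqof m c j).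
  move=> bE; apply: piP; have [|K KP] := frac_eq (num b) (den b) c j.
    by rewrite -numP.
  by exists K => k /KP; rewrite /seqof => ->.
have beta_bil : is_bilinear beta.
  split=> [b|m] c x y.
    rewrite /beta -linearP; congr (pi _); apply/funext => k.
    by rewrite /seqof addrfctE scalrfctE scalerDr !scalerA [_ * c]mulrC.
  rewrite (betaE _ (c *: x + y) (c * num x * a ^+ den y + num y * a ^+ den x) (den x + den y)%N).
    rewrite /beta -linearP; apply: piP; exists (den x + den y)%N => k le_k.
    rewrite /seqof addrfctE scalrfctE /= scalerA -scalerDl; congr (_ *: _).
    have [l ->] : exists l, k = (l + (den x + den y))%N.
      by exists (k - (den x + den y))%N; rewrite subnK.
    have -> : (l + (den x + den y) - den x = l + den y)%N.
      by rewrite [(den x + _)%N]addnC addnA addnK.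
    rewrite addnK addnA addnK !exprD; ring.
  rewrite -[c *: x]/(f c * (x : B)) {1}(numP x) {1}(numP y).
  rewrite (fracM (num x) _ (den y)) (fracM (num y) _ (den x)).
  by rewrite [(den y + _)%N]addnC mulrA -mulrDl !rmorphD !rmorphM; congr (_ * _); ring.
have t_bil := t_tens.1; have t'_bil := t'_tens.1.
have t_frac (m : M) j k : t m (i ^+ j) = t (a ^+ k *: m) (i ^+ (j + k)).
  rewrite (bilinZl t_bil) -(bilinZr t_bil); congr (t m _).
  rewrite -[RHS]/(f (a ^+ k) * i ^+ (j + k)) -[LHS]mul1r -(rmorph1 f).
  by rewrite (fracM 1 j k) mulr1.
have [g gE _] := t'_tens.2 Q beta beta_bil.
apply: raddf_inj => z.
have [m [j ->]] : exists m j, z = t m (i ^+ j).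
  apply: (tensor_span (t := t) (W := fun z => exists m j, z = t m (i ^+ j))) => //.
  - by exists 0, 0%N; rewrite (bilin0l t_bil).
  - move=> _ _ [m [j ->]] [m' [j' ->]].
    exists (a ^+ j' *: m + a ^+ j *: m'), (j + j')%N.
    by rewrite (bilinDl t_bil) -t_frac [(j + j')%N]addnC -t_frac.
  - by move=> b _ [m [j ->]]; exists (b *: m), j; rewrite (bilinZl t_bil).
  move=> m b; have [c [j bE]] := Bfrac b; exists (c *: m), j.
  by rewrite (bilinZl t_bil) -(bilinZr t_bil) [in LHS]bE.
move=> vz; have : g (v (t m (i ^+ j))) = 0 by rewrite [v _]vz raddf0.
rewrite vE gE.
rewrite (betaE (u m) (i ^+ j) 1 j) ?rmorph1 ?mul1r // => /pi_ker[K /(_ (K + j)%N)].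
rewrite leq_addr /seqof addnK mulr1 -linearZ => /(_ isT) /eqP.
rewrite -(raddf0 u) => /eqP /u_inj am0.
by rewrite (t_frac m j K) am0 (bilin0l t_bil).
Qed.

(** * Simple ring extensions A[X]/(r) and their retractions *)

(** Polynomials need a nonzero coefficient ring. Destructing the ring makes the
    two structures equal and not merely isomorphic, so the conclusion can be
    substituted away. *)
Lemma comNz_of_comPz (A : comPzRingType) :
  (1 : A) <> 0 -> exists A' : comNzRingType, A = A' :> comPzRingType.
Proof.
move=> /eqP A1; case: A A1 => T [] m1 m2 m3 m4 m5 m6 m7 m8 m9 m10 m11.
pose A := GRing.ComPzRing.Pack 
  (@GRing.ComPzRing.Class T m1 m2 m3 m4 m5 m6 m7 m8 m9 m10 m11).
rewrite -/A => A1; pose nz := GRing.PzSemiRing_isNonZero.Build A A1.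
pose A' : comNzRingType := HB.pack T A nz.
by exists A'.
Qed.

Lemma poly_polynomial_algebra (A : comNzRingType) :
  is_polynomial_algebra (polyC : {rmorphism A -> {poly A}}) (fun _ : 'I_1 => 'X).
Proof.
move=> C g y.
have uniq (h h' : {rmorphism {poly A} -> C}) :
    (forall a, h a%:P = g a) -> (forall i : 'I_1, h 'X = y i) ->
    (forall a, h' a%:P = g a) -> (forall i : 'I_1, h' 'X = y i) -> h' =1 h.
  move=> hC hX h'C h'X; elim/poly_ind => [|p c IHp]; first by rewrite !rmorph0.
  by rewrite !rmorphD !rmorphM IHp hC h'C (hX ord0) (h'X ord0).
suff [h [hC hX]] : exists h : {rmorphism {poly A} -> C},
    (forall a, h a%:P = g a) /\ (forall i, h 'X = y i).
  by exists h => // h' h'C h'X; exact: uniq.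
have [C1|/comNz_of_comPz[C' eqC]] := pselect ((1 : C) = 0).
  have C0 (c : C) : c = 0 by rewrite -[c]mul1r C1 mul0r.
  have zB : zmod_morphism (fun _ : {poly A} => 0 : C) by move=> p q; rewrite subr0.
  have zM : monoid_morphism (fun _ : {poly A} => 0 : C).
    by split=> [|p q]; rewrite ?C1 ?mulr0.
  pose zadd := GRing.isZmodMorphism.Build _ _ _ zB.
  pose zmul := GRing.isMonoidMorphism.Build _ _ _ zM.
  pose h : {rmorphism {poly A} -> C} := HB.pack (fun _ : {poly A} => 0 : C) zadd zmul.
  by exists h; split=> ?; rewrite [LHS]C0 [RHS]C0.
subst C; have cgy : commr_rmorph g (y ord0) by move=> a; apply: mulrC.
exists (horner_morph cgy); split=> [a|i].
  exact: (horner_morphC cgy).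
by rewrite (ord1 i); exact: (horner_morphX cgy).
Qed.

Section SimpleExtension.
Variables (A : comNzRingType) (B : comPzRingType) (r : {poly A}).
Variable (pi : {rmorphism {poly A} -> B}).
Hypothesis pi_surj : forall b, exists p, pi p = b.
Hypothesis pi_ker : forall p, pi p = 0 <-> exists w, p = w * r.

Let f : {rmorphism A -> B} := pi \o polyC.

Lemma simple_finite_presentation : finite_presentation f.
Proof.
exists 1%N, {poly A}, polyC, (fun=> 'X); split; first exact: poly_polynomial_algebra.
exists pi; split=> //; exists 1%N, (fun=> r) => p; rewrite pi_ker.
split=> [[w ->]|[s ->]]; first by exists (fun=> w); rewrite big_ord1.
by exists (s ord0); rewrite big_ord1.
Qed.

(** A derivation D over A satisfies D (p(x)) = p'(x) D x, so that
    0 = D (r(x)) = r'(x) D x forces D x = 0. *)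
Lemma simple_unramified : (exists u, u * pi r^`() = 1) -> unramified f.
Proof.
move=> [u ur]; exists 'rV[B]_0, (fun=> 0).
split; last by move=> w; exact: thinmx0.
split=> [|M D [DD DM Df]].
  by split=> // x y; rewrite ?addr0 // !scaler0 addr0.
have D0 : D 0 = 0 by rewrite -(rmorph0 f).
have DE p : D (pi p) = pi p^`() *: D (pi 'X).
  elim/poly_ind: p => [|p c IHp]; first by rewrite deriv0 rmorph0 D0 scale0r.
  rewrite rmorphD DD [D (pi c%:P)]Df addr0 rmorphM DM IHp scalerA -scalerDl.
  rewrite derivMXaddC rmorphD rmorphM; congr (_ *: _); ring.
have DX : D (pi 'X) = 0.
  have pir0 : pi r = 0 by apply/pi_ker; exists 1; rewrite mul1r.
  by rewrite -[LHS]scale1r -ur -scalerA -DE pir0 D0 scaler0.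
exists (\0 : {linear 'rV[B]_0 -> M}) => [x|h' _ w]; last by rewrite (thinmx0 w) !raddf0.
by have [p <-] := pi_surj x; rewrite DE DX scaler0.
Qed.

Lemma simple_nonzero : ~ (exists w, w * r = 1) -> (1 : B) <> 0.
Proof. by move=> r1; rewrite -(rmorph1 pi) => /pi_ker[w wr]; apply: r1; exists w. Qed.

Lemma simple_root (g : {rmorphism B -> A}) : cancel f g -> root r (g (pi 'X)).
Proof.
move=> fK; have gE p : g (pi p) = p.[g (pi 'X)].
  elim/poly_ind: p => [|p c IHp]; first by rewrite !rmorph0 horner0.
  by rewrite hornerMXaddC !rmorphD !rmorphM IHp [g (pi c%:P)]fK.
by rewrite /root -gE; have /pi_ker -> : exists w, r = w * r;
  [exists 1; rewrite mul1r | rewrite rmorph0].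
Qed.

End SimpleExtension.

(** A retraction of A[X]/(r) sends the class of X to a root of r. *)
Lemma point_root (A : comNzRingType) (r : {poly A}) :
  is_point A -> ~ (exists w, w * r = 1) ->
  (forall (B : comPzRingType) (pi : {rmorphism {poly A} -> B}),
     (forall b, exists p, pi p = b) -> (forall p, pi p = 0 <-> exists w, p = w * r) ->
     flat (pi \o polyC) /\ exists u, u * pi r^`() = 1) ->
  exists a, root r a.
Proof.
move=> [_ A_point] r1 r_etale.
have [|B [pi [pi_surj pi_ker]]] := @quotient_ring {poly A} (fun p => exists w, p = w * r).
  split=> [|_ _ [v ->] [w ->]|v _ [w ->]]; first by exists 0; rewrite mul0r.
    by exists (v + w); rewrite mulrDl.
  by exists (v * w); rewrite mulrA.
have [r_flat r_unr] := r_etale B pi pi_surj pi_ker.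
have [||g fK] := A_point B (pi \o polyC).
- split; last exact: (simple_finite_presentation pi_surj pi_ker).
  by split=> //; exact: (simple_unramified pi_surj pi_ker).
- exact: (simple_nonzero pi_ker r1).
by exists (g (pi 'X)); exact: (simple_root pi_ker fK).
Qed.

(** Comparing coefficients gives w_k = - a^k c, and w has only finitely many
    nonzero coefficients. *)
Lemma localization_torsion (A : comNzRingType) (a c : A) (w : {poly A}) :
  c%:P = w * (a *: 'X - 1) -> exists k, a ^+ k * c = 0.
Proof.
move=> cE; have wE k : w`_k = - (a ^+ k * c).
  elim: k => [|k IHk]; have /(congr1 (fun p : {poly A} => p`_0)) := cE.
    by rewrite coefC mulrBr mulr1 -scalerAr coefB coefZ coefMX /= mulr0 sub0r
      => ->; rewrite mul1r opprK.
  move=> _; have /(congr1 (fun p : {poly A} => p`_k.+1)) := cE.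
  rewrite coefC mulrBr mulr1 -scalerAr coefB coefZ coefMX /= IHk.
  by move=> /eqP; rewrite eq_sym subr_eq0 => /eqP <-; rewrite exprS mulrN mulrA.
exists (size w); have := wE (size w); rewrite nth_default //.
by move=> /eqP; rewrite eq_sym oppr_eq0 => /eqP.
Qed.

(** A root of aX - 1 is an inverse of a; the extension is nonzero because a is
    not nilpotent. *)
Lemma point_nilpotent_or_unit (A : comNzRingType) (a : A) :
  is_point A -> (forall k, a ^+ k <> 0) -> exists b, a * b = 1.
Proof.
move=> A_point a_nnil.
have [|B pi pi_surj pi_ker|b] := @point_root A (a *: 'X - 1) A_point.
- move=> [w w1]; have [|k] := @localization_torsion A a 1 w; first by rewrite w1.
  by rewrite mulr1; exact: a_nnil.
- have ai : pi a%:P * pi 'X = 1.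
    apply/eqP; rewrite -rmorphM -subr_eq0 -(rmorph1 pi) -rmorphB; apply/eqP/pi_ker.
    by exists 1; rewrite mul1r mul_polyC.
  split; last by exists (pi 'X); rewrite derivB derivC subr0 derivZ derivX
    alg_polyC mulrC.
  apply: (@flat_localization A B (pi \o polyC) a (pi 'X) ai) => [b|c].
    have [p <-] := pi_surj b; elim/poly_ind: p => [|p c [c' [j IHp]]].
      by exists 0, 0%N; rewrite !rmorph0 mul0r.
    exists (c' + c * a ^+ j.+1), j.+1.
    rewrite [pi (p * _ + _)]rmorphD [pi (p * _)]rmorphM IHp /=.
    rewrite polyCD polyCM polyC_exp rmorphD !rmorphM rmorphXn.
    have aj : pi a%:P ^+ j.+1 * pi 'X ^+ j.+1 = 1 by rewrite -exprMn ai expr1n.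
    by rewrite mulrDl -[X in _ = _ + X]mulrA aj mulr1 [in RHS]exprSr mulrA.
  by move=> /pi_ker[w /localization_torsion].
by rewrite /root !hornerE => /eqP /subr0_eq ab; exists b.
Qed.

(** * Points are nilpotent extensions of separably closed fields *)

Definition nilpotent (R : comPzRingType) (x : R) := exists n, x ^+ n = 0.

Lemma nilpotent_ideal (R : comPzRingType) : is_ideal (@nilpotent R).
Proof.
split=> [|x y [m xm] [n yn]|a x [n xn]]; first by exists 1%N; rewrite expr1.
  exists (m + n)%N; rewrite exprDn big1 // => i _.
  have [le_ni|lt_in] := leqP n i.
    by rewrite -(subnK le_ni) exprD yn !mulr0 mul0rn.
  by rewrite -addnBA ?(ltnW lt_in) // exprD xm !mul0r mul0rn.
by exists n; rewrite exprMn xn mulr0.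
Qed.

(** Geometric series. *)
Lemma nilpotent_unit (R : comPzRingType) (x : R) :
  nilpotent x -> exists u, u * (1 - x) = 1.
Proof.
move=> [n xn]; exists (\sum_(i < n) x ^+ i).
by have := subrX1 x n; rewrite xn sub0r -opprB mulNr mulrC => /oppr_inj.
Qed.

Lemma nilpotent_poly (A : comNzRingType) (p : {poly A}) :
  (forall i, nilpotent p`_i) -> nilpotent p.
Proof.
have [n0 nD nM] := @nilpotent_ideal {poly A}.
elim/poly_ind: p => [|p c IHp] pnil; first exact: n0.
have {}IHp : nilpotent p by apply: IHp => i; have := pnil i.+1;
  rewrite coefD coefMX coefC addr0.
apply: nD; first by rewrite mulrC; exact: nM.
have [n cn] := pnil 0%N; exists n; move: cn.
by rewrite coefD coefMX coefC add0r -polyC_exp => ->.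
Qed.

(** Tensoring with a free module of basis e is taking n copies; co gives the
    coordinates, and the maps m' (x) b |-> co i b *: m' detect them in the
    tensor product. *)
Lemma flat_free (A B : comPzRingType) (f : {rmorphism A -> B}) (n : nat)
    (e : 'I_n -> B) (co : 'I_n -> B -> A) :
  (forall b, b = \sum_i f (co i b) * e i) ->
  (forall i a x y, co i (f a * x + y) = a * co i x + co i y) ->
  (forall i j, co i (e j) = (i == j)%:R) -> flat f.
Proof.
move=> coK co_lin co_e M M' u u_inj T T' t t' t_tens t'_tens v vE.
have t_bil := t_tens.1.
apply: raddf_inj => z.
have [m ->] : exists m : 'I_n -> M, z = \sum_i t (m i) (e i).
  pose W z := exists m : 'I_n -> M, z = \sum_i t (m i) (e i).
  apply: (tensor_span (t := t) (W := W)) => //.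
  - by exists (fun=> 0); rewrite big1 // => i _; rewrite (bilin0l t_bil).
  - move=> _ _ [m ->] [m' ->]; exists (fun i => m i + m' i).
    by rewrite -big_split; apply: eq_bigr => i _; rewrite (bilinDl t_bil).
  - move=> a _ [m ->]; exists (fun i => a *: m i).
    by rewrite scaler_sumr; apply: eq_bigr => i _; rewrite (bilinZl t_bil).
  move=> m b; exists (fun i => co i b *: m).
  rewrite [in LHS](coK b) (bilin_sumr t_bil); apply: eq_bigr => i _.
  by rewrite (bilinZl t_bil) -(bilinZr t_bil).
move=> vz; rewrite big1 // => i _; suff -> : m i = 0 by rewrite (bilin0l t_bil).
pose beta (m : M') (b : restr_scalars f) := co i b *: m.
have beta_bil : is_bilinear beta.
  split=> [b|m'] a x y; rewrite /beta.
    by rewrite scalerDr !scalerA mulrC.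
  by rewrite -[a *: x]/(f a * (x : B)) co_lin scalerDl scalerA.
have [g gE _] := t'_tens.2 _ beta beta_bil.
have : g (v (\sum_i t (m i) (e i))) = 0 by rewrite [v _]vz raddf0.
rewrite !raddf_sum (bigD1 i) //= big1 ?addr0 => [|j].
  by rewrite vE gE /beta co_e eqxx scale1r -(raddf0 u) => /u_inj.
by rewrite vE gE /beta co_e eq_sym => /negbTE ->; rewrite scale0r.
Qed.

(** The remainders of the division by r give the coordinates in the basis of
    the powers of X below the degree of r. *)
Lemma flat_monic (A : comNzRingType) (B : comPzRingType) (r : {poly A})
    (pi : {rmorphism {poly A} -> B}) :
  r \is monic -> (forall b, exists p, pi p = b) ->
  (forall p, pi p = 0 <-> exists w, p = w * r) -> flat (pi \o polyC).
Proof.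
move=> r_mon pi_surj pi_ker; have [s sK] := choice pi_surj.
pose n := (size r).-1; have r0 : r != 0 := monic_neq0 r_mon.
have size_r : size r = n.+1 by rewrite prednK // lt0n size_poly_eq0.
have modE p : rmodp (s (pi p)) r = rmodp p r.
  have /pi_ker[w wE] : pi (s (pi p) - p) = 0 by rewrite rmorphB sK subrr.
  by rewrite -(subrK p (s (pi p))) wE rmodpD // rmodp_mull // add0r.
pose co (i : 'I_n) b := (rmodp (s b) r)`_i.
apply: (@flat_free _ _ _ n (fun i => pi 'X^i) co) => [b|i a x y|i j].
- rewrite -[LHS]sK (rdivp_eq r_mon (s b)) rmorphD.
  have -> : pi (rdivp (s b) r * r) = 0 by apply/pi_ker; eexists.
  rewrite add0r -{1}(coefK (rmodp (s b) r)) poly_def rmorph_sum.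
  rewrite (big_ord_widen n (fun i => pi ((rmodp (s b) r)`_i *: 'X^i))); last first.
    by rewrite -ltnS -size_r ltn_rmodpN0.
  rewrite [RHS](bigID (fun i : 'I_n => (i < size (rmodp (s b) r))%N)) /=.
  rewrite [X in _ = _ + X]big1 ?addr0 => [|i].
    by apply: eq_bigr => i _; rewrite -mul_polyC rmorphM.
  by rewrite -leqNgt /co => le_i; rewrite nth_default // polyC0 rmorph0 mul0r.
- rewrite /co -{1}(sK x) -{1}(sK y) /= -rmorphM -rmorphD modE rmodpD // mul_polyC.
  by rewrite rmodpZ // coefD coefZ.
by rewrite /co modE rmodp_small ?coefXn // size_polyXn size_r ltnS.
Qed.

Lemma lift_poly (A : comNzRingType) (K : fieldType) (phi : {rmorphism A -> K}) :
  (forall y, exists x, phi x = y) -> forall q : {poly K}, exists p, map_poly phi p = q.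
Proof.
move=> /choice[s sK] q; exists (\poly_(i < size q) s q`_i).
apply/polyP=> i; rewrite coef_map coef_poly; case: ltnP => [_|le_i].
  exact: sK.
by rewrite /= rmorph0 nth_default.
Qed.

Lemma lift_monic (A : comNzRingType) (K : fieldType) (phi : {rmorphism A -> K}) :
  (forall y, exists x, phi x = y) -> forall q : {poly K}, q \is monic ->
  exists2 p, map_poly phi p = q & p \is monic.
Proof.
move=> phi_surj q q_mon.
have size_q : size q = (size q).-1.+1 by rewrite prednK // lt0n size_poly_eq0 monic_neq0.
pose n := (size q).-1; have [p0 p0E] := lift_poly phi_surj (q - 'X^n).
pose p1 := \poly_(i < n) p0`_i.
have size_p1 : (size p1 < size ('X^n : {poly A}))%N.
  by rewrite size_polyXn ltnS size_poly.
exists ('X^n + p1); last by rewrite monicE lead_coefDl // lead_coefXn.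
rewrite rmorphD /= map_polyXn; apply/polyP=> i; rewrite coefD coefXn coef_map coef_poly.
have p0i j : phi p0`_j = q`_j - (j == n)%:R by rewrite -coef_map p0E coefB coefXn.
have [lt_in|lt_ni|->] := ltngtP i n.
- by rewrite /= p0i (ltn_eqF lt_in) subr0 add0r.
- by rewrite /= [phi _]rmorph0 addr0 nth_default // size_q -/n.
by rewrite /= [phi _]rmorph0 addr0; move/monicP: q_mon.
Qed.

(** Lift a monic separable q to a monic r. The Bezout relation u1 q + u2 q' = 1
    lifts to an identity with an error eps whose coefficients are nilpotent, so
    1 - eps is invertible and r' is a unit modulo r. *)
Lemma point_separably_closed (A : comNzRingType) (K : fieldType)
    (phi : {rmorphism A -> K}) :
  is_point A -> nilpotent_extension phi -> separably_closed K.
Proof.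
move=> A_point [phi_surj phi_ker] q0 q0_sep size_q0.
have q0_n0 : q0 != 0 by rewrite -size_poly_gt0 ltnW.
pose q := (lead_coef q0)^-1 *: q0.
have c0 : (lead_coef q0)^-1 != 0 by rewrite invr_eq0 lead_coef_eq0.
have q_mon : q \is monic by rewrite monicE lead_coefZ mulVf // lead_coef_eq0.
have q_sep : separable_poly q.
  by move: q0_sep; rewrite unlock derivZ coprimepZl // coprimepZr.
have [r rE r_mon] := lift_monic phi_surj q_mon.
have [|B pi pi_surj pi_ker|a] := @point_root A r A_point.
- move=> [w /(congr1 (map_poly phi))]; rewrite rmorphM /= rE rmorph1 => wq.
  have : (q : {poly K}) %| 1 by rewrite -wq dvdp_mull.
  rewrite dvdp1 => /eqP size_q.
  by rewrite -(size_scale q0 c0) -/q size_q in size_q0.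
- split; first exact: (flat_monic r_mon pi_surj pi_ker).
  have [[u1 u2] /= uq] : exists u : {poly K} * {poly K}, u.1 * q + u.2 * q^`() = 1.
    by apply/Bezout_eq1_coprimepP; move: q_sep; rewrite unlock.
  have [v1 v1E] := lift_poly phi_surj u1; have [v2 v2E] := lift_poly phi_surj u2.
  pose eps := 1 - (v1 * r + v2 * r^`()).
  have /nilpotent_unit[u uE] : nilpotent eps.
    apply: nilpotent_poly => i; apply: phi_ker; rewrite -coef_map.
    rewrite rmorphB rmorphD !rmorphM rmorph1 /= -deriv_map rE v1E v2E uq.
    by rewrite subrr coef0.
  exists (pi (u * v2)); rewrite -rmorphM; apply/eqP; rewrite -subr_eq0 -(rmorph1 pi).
  rewrite -rmorphB; apply/eqP/pi_ker; exists (- u * v1).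
  by rewrite -uE /eps; ring.
move=> /eqP ra0; exists (phi a).
by rewrite -(rootZ _ _ c0) -/q -rE /root horner_map /= ra0 rmorph0.
Qed.

Lemma point_is_nilpotent_extension (A : comPzRingType) :
  is_point A -> exists (K : fieldType) (p : {rmorphism A -> K}),
    separably_closed K /\ nilpotent_extension p.
Proof.
move=> A_point; have [A' eqA] := comNz_of_comPz A_point.1; subst A.
have idA := @nilpotent_ideal A'.
have [||K [phi [phi_surj phi_ker]]] := quotient_field idA.
- by move=> [n]; rewrite expr1n; exact: A_point.1.
- move=> x x_nnil; have [k xk|y xy] := point_nilpotent_or_unit (a := x) A_point.
    by apply: x_nnil; exists k.
  by exists y; rewrite mulrC xy subrr; case: idA.
have K_ext : nilpotent_extension phi by split=> // x /phi_ker.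
by exists K, phi; split=> //; exact: point_separably_closed A_point K_ext.
Qed.

(** * Derivations and separably closed fields *)

(** By induction on the degree: a simple root x of f stays a simple root of one
    factor of any factorisation of f. If f is not separable, split off
    gcd(f, f'), which does not vanish at x; if f is separable, it has a root a
    in K, and X - a can be split off unless x = a. *)
Lemma separable_root_in_base (K L : fieldType) (iota : {rmorphism K -> L}) :
  separably_closed K -> forall (f : {poly K}) (x : L),
  (map_poly iota f).[x] = 0 -> (map_poly iota f^`()).[x] != 0 ->
  exists a, x = iota a.
Proof.
move=> K_sc f x; have [n] := ubnP (size f); elim: n f => // n IHn f size_f fx f'x.
have step (g h : {poly K}) : f = g * h -> (map_poly iota g).[x] != 0 ->
    (1 < size g)%N -> exists a, x = iota a.
  move=> fE gx size_g.
  have hx : (map_poly iota h).[x] = 0.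
    move: fx; rewrite fE rmorphM hornerM => /eqP.
    by rewrite mulf_eq0 (negbTE gx) => /eqP.
  have f0 : f != 0.
    by apply: contraNneq f'x => ->; rewrite deriv0 rmorph0 horner0.
  have [g0 h0] : g != 0 /\ h != 0.
    by split; apply: contraNneq f0 => E; rewrite fE E ?mulr0 ?mul0r.
  apply: (IHn h) => //.
    move: size_f size_g; rewrite fE size_mul //.
    by move: (size g) (size h) => a b; lia.
  by move: f'x; rewrite fE derivM rmorphD !rmorphM hornerD !hornerM hx mulr0 add0r
    mulf_eq0 (negbTE gx).
have f_n0 : f != 0 by apply: contraNneq f'x => ->; rewrite deriv0 rmorph0 horner0.
have [f_sep|] := boolP (separable_poly f).
  have size_f1 : (1 < size f)%N.
    rewrite ltnNge; apply: contra f'x => /size1_polyC ->.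
    by rewrite derivC rmorph0 horner0.
  have [a fa] := K_sc f f_sep size_f1.
  have [->|xa] := eqVneq x (iota a); first by exists a.
  have /factor_theorem[h fE] := fa.
  apply: (step ('X - a%:P) h); rewrite ?size_XsubC //; first by rewrite mulrC.
  by rewrite map_polyXsubC hornerXsubC subr_eq0.
rewrite unlock coprimep_def => gcd1.
have gf : gcdp f f^`() %| f := dvdp_gcdl _ _.
apply: (step (gcdp f f^`()) (f %/ gcdp f f^`())).
- by rewrite mulrC divpK.
- apply: contraNneq f'x => gx; rewrite -(divpK (dvdp_gcdr f f^`())).
  by rewrite rmorphM hornerM /= gx mulr0.
by rewrite ltn_neqAle eq_sym gcd1 lt0n size_poly_eq0 gcdp_eq0 negb_and f_n0.
Qed.

(** Derivations into L, seen as a module over the source through ev. Total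
    functions out of polynomial rings replace derivations of subrings of L: a
    derivation of the image of ev is one that kills the kernel of ev. *)
Definition derivation_along (R L : comPzRingType) (ev D : R -> L) :=
  (forall a b, D (a + b) = D a + D b) /\
  (forall a b, D (a * b) = ev a * D b + ev b * D a).

Section ExtendDerivation.
Variables (R : comNzRingType) (L : fieldType) (ev : {rmorphism R -> L}) (x : L).

Let evx (q : {poly R}) := (map_poly ev q).[x].

(** The polynomials that vanish at x are, up to scalars, multiples of a single
    one, so that derivations at x are determined on them by one value. This is
    Euclid's algorithm: cancelling leading terms replaces p by s, with
    D s = c D p - u D q for both derivations since p and q vanish at x. *)
Lemma derivations_proportional (D1 D2 : {poly R} -> L) :
  derivation_along evx D1 -> derivation_along evx D2 ->
  (forall q, map_poly ev q = 0 -> D1 q = 0) ->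
  (forall q, map_poly ev q = 0 -> D2 q = 0) ->
  forall p q, evx p = 0 -> evx q = 0 -> D1 p * D2 q = D1 q * D2 p.
Proof.
move=> D1_der D2_der D1_ker D2_ker p q.
have [n] := ubnP (size (map_poly ev p) + size (map_poly ev q))%N.
elim: n p q => // n IHn p q; rewrite ltnS => le_n px qx.
wlog le_pq : p q le_n px qx / (size (map_poly ev q) <= size (map_poly ev p))%N.
  have [le_pq|/ltnW le_qp] := leqP (size (map_poly ev q)) (size (map_poly ev p)).
    by apply.
  by move=> /(_ q p) wl; symmetry; apply: wl => //; rewrite addnC.
have [q0|q_n0] := eqVneq (map_poly ev q) 0.
  by rewrite (D1_ker q q0) (D2_ker q q0) mulr0 mul0r.
set np := size _ in le_n le_pq; set nq := size (map_poly ev q) in le_n le_pq.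
have nq_gt0 : (0 < nq)%N by rewrite lt0n size_poly_eq0.
pose c := q`_nq.-1; pose d := p`_np.-1; pose k := (np - nq)%N.
pose s := c%:P * p - (d *: 'X^k) * q.
have c_n0 : ev c != 0 by rewrite -coef_map -lead_coefE lead_coef_eq0.
have evM u v : evx (u * v) = evx u * evx v by rewrite /evx rmorphM hornerM.
have evC a : evx a%:P = ev a by rewrite /evx map_polyC hornerC.
have DE (D : {poly R} -> L) : derivation_along evx D ->
    D s = ev c * D p - evx (d *: 'X^k) * D q.
  move=> [DD DM]; have D0 : D 0 = 0 by apply: (addrI (D 0)); rewrite -DD !addr0.
  have DN u : D (- u) = - D u by apply/eqP; rewrite -addr_eq0 -DD addNr D0.
  by rewrite /s DD DN !DM px qx !mul0r !addr0 evC.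
have sx : evx s = 0 by rewrite /evx rmorphB hornerD hornerN -!/(evx _) !evM px qx !mulr0 subrr.
have size_s : (size (map_poly ev s) < np)%N.
  have np_gt0 : (0 < np)%N := leq_trans nq_gt0 le_pq.
  rewrite -(prednK np_gt0) ltnS; apply/leq_sizeP => j le_j.
  rewrite coef_map coefB coefCM -scalerAl coefZ coefXnM.
  have -> : (j < k)%N = false by rewrite /k; lia.
  rewrite /= rmorphB !rmorphM -!coef_map.
  have [le_npj|lt_jnp] := leqP np j.
    have le_nqj : (nq <= j - k)%N by rewrite /k; lia.
    by rewrite [_`_j]nth_default // [_`_(j - k)]nth_default // !mulr0 subrr.
  have -> : j = np.-1 by lia.
  have -> : (np.-1 - k)%N = nq.-1 by rewrite /k; lia.
  by rewrite mulrC subrr.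
have IH := IHn s q _ sx qx; rewrite -/nq in IH.
have {IH}/IH : (size (map_poly ev s) + nq < n)%N by lia.
rewrite !DE // => eq_s; apply: (mulfI c_n0); apply/eqP; rewrite -subr_eq0.
have -> : ev c * (D1 p * D2 q) - ev c * (D1 q * D2 p) =
  (ev c * D1 p - evx (d *: 'X^k) * D1 q) * D2 q -
  D1 q * (ev c * D2 p - evx (d *: 'X^k) * D2 q) by ring.
by rewrite eq_s subrr.
Qed.

(** Leibniz rule for the derivation that acts on coefficients only. *)
Lemma coef_derivation (D : {additive R -> L}) :
  derivation_along ev D -> derivation_along evx (fun q => (map_poly D q).[x]).
Proof.
move=> [_ DM]; split=> p q; first by rewrite raddfD hornerD.
rewrite /evx -!hornerM -hornerD; congr _.[x].
apply/polyP => i; rewrite coefD coefM coefMr coef_map coefM raddf_sum /=.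
by rewrite -big_split; apply: eq_bigr => j _ /=; rewrite !coef_map DM.
Qed.

Lemma deriv_derivation :
  derivation_along evx (fun q => (map_poly ev q)^`().[x]).
Proof.
split=> p q; first by rewrite rmorphD derivD hornerD.
by rewrite rmorphM derivM hornerD !hornerM /evx; ring.
Qed.

End ExtendDerivation.

(** R is an iterated polynomial ring over K with one variable for each element
    of s, evaluated in L by ev. The hypothesis says that the image of ev has no
    nonzero K-derivation into L, the conclusion that this image is K. *)
Lemma tower_without_derivation (K L : fieldType) (iota : {rmorphism K -> L})
    (s : seq L) :
  separably_closed K ->
  exists (R : comNzRingType) (k : {rmorphism K -> R}) (ev : {rmorphism R -> L}),
  [/\ forall a, ev (k a) = iota a,
      forall y, y \in s -> exists r, ev r = y
    & (forall D : R -> L, derivation_along ev D -> (forall a, D (k a) = 0) ->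
         (forall r, ev r = 0 -> D r = 0) -> forall r, D r = 0) ->
      forall r, exists a, ev r = iota a].
Proof.
move=> K_sc; elim: s => [|x s [R [k [ev [ev_k ev_s R_noder]]]]].
  by exists K, idfun, iota; split=> // _ r; exists r.
have cx : commr_rmorph ev x by move=> r; exact: mulrC.
exists {poly R}, (polyC \o k), (horner_morph cx).
set evx := horner_morph cx; split=> [a|y|noder].
- by rewrite -ev_k; exact: horner_morphC.
- rewrite inE => /orP[/eqP->|/ev_s[r <-]].
    by exists 'X; exact: horner_morphX.
  by exists r%:P; exact: horner_morphC.
pose dv q := (map_poly ev q)^`().[x].
have dv_der : derivation_along evx dv := deriv_derivation ev x.
(* Otherwise d/dx would vanish on the kernel of evx, hence everywhere, although
   it takes the value 1 at X. *)
have [p px p'x] : exists2 p, evx p = 0 & dv p != 0.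
  apply: contrapT => no_p; have /eqP := oner_neq0 L; apply.
  have <- : dv 'X = 1 by rewrite /dv map_polyX derivX hornerC.
  apply: (noder dv dv_der) => [a|q qx].
    by rewrite /dv /= map_polyC derivC hornerC.
  by apply: contrapT => /eqP q'x; apply: no_p; exists q.
(* A derivation D of the ring below extends: the value at X is chosen so that
   the extension E kills p, hence every polynomial vanishing at x. *)
have {}R_noder : forall r, exists a, ev r = iota a.
  apply: R_noder => D D_der Dk D_ker r.
  have D0 : D 0 = 0 by apply: (addrI (D 0)); rewrite -D_der.1 !addr0.
  have DB : zmod_morphism D.
    move=> u v; apply/eqP; rewrite -(inj_eq (addIr (D v))) subrK.
    by rewrite -D_der.1 subrK.
  pose D' : {additive R -> L} := HB.pack D (GRing.isZmodMorphism.Build _ _ D DB).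
  pose hat q := (map_poly D' q).[x].
  have hat_der : derivation_along evx hat := coef_derivation (D := D') x D_der.
  pose E q := hat q + dv q * (- (hat p / dv p)).
  have <- : E r%:P = D r.
    by rewrite /E /hat /dv !map_polyC derivC !hornerC mul0r addr0.
  apply: noder => [|a|q qx].
  - by split=> u v; rewrite /E ?hat_der.1 ?dv_der.1 ?hat_der.2 ?dv_der.2; ring.
  - rewrite -[LHS]/(E (k a)%:P) /E /hat /dv !map_polyC derivC !hornerC.
    by rewrite [X in X + _]Dk mul0r addr0.
  have hat_ker u : map_poly ev u = 0 -> hat u = 0.
    move=> u0; rewrite /hat; have -> : map_poly D' u = 0; last exact: horner0.
    by apply/polyP => i; rewrite coef_map coef0 /= D_ker // -coef_map u0 coef0.
  have dv_ker u : map_poly ev u = 0 -> dv u = 0.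
    by rewrite /dv => ->; rewrite deriv0 horner0.
  have := derivations_proportional hat_der dv_der hat_ker dv_ker px qx.
  rewrite /E => prop; apply/eqP; rewrite mulrN mulrA subr_eq0 eq_sym.
  by rewrite -(inj_eq (mulIf p'x)) divfK // mulrC prop.
have [al alE] := choice R_noder.
have [a xE] : exists a, x = iota a.
  pose pK := \poly_(i < size p) al p`_i.
  have pKE : map_poly iota pK = map_poly ev p.
    apply/polyP => i; rewrite !coef_map coef_poly /=; case: ltnP => [_|le_i].
      by rewrite -alE.
    by rewrite nth_default // !rmorph0.
  by apply: (separable_root_in_base K_sc (f := pK)); rewrite -?deriv_map pKE.
elim/poly_ind => [|q c [b qE]]; first by exists 0; rewrite !rmorph0.
exists (b * a + al c); rewrite !rmorphD !rmorphM qE -alE -xE.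
by congr (_ * _ + _); [exact: horner_morphX|exact: horner_morphC].
Qed.

(** * Residue points of unramified algebras *)

(** Zorn's lemma. The sets considered are not required to contain 0, so that
    the union of the empty chain is among them; a maximal one contains 0. *)
Lemma maximal_ideal (B : comPzRingType) :
  (1 : B) <> 0 -> exists I : B -> Prop,
    [/\ is_ideal I, ~ I 1 & forall x, ~ I x -> exists y, I (y * x - 1)].
Proof.
move=> B1.
pose P (I : set B) := [/\ forall x y, I x -> I y -> I (x + y),
  forall a x, I x -> I (a * x) & ~ I 1].
have [F FP Ftot|I [[ID IM I1] Imax]] := @Zorn_bigcup B P.
  split=> [x y [X FX Xx] [Y FY Yy]|a x [X FX Xx]|[X FX X1]].
  - have [XY|YX] := Ftot X Y FX FY.
      by exists Y => //; have [YD _ _] := FP Y FY; apply: YD => //; exact: XY.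
    by exists X => //; have [XD _ _] := FP X FX; apply: XD => //; exact: YX.
  - by exists X => //; have [_ XM _] := FP X FX; apply: XM.
  by have [_ _ nX1] := FP X FX; exact: nX1.
have adjoin x : ~ I x -> exists c, I (1 - c * x) \/ 1 = c * x.
  move=> Ix; pose J : set B := fun z => exists c, I (z - c * x) \/ z = c * x.
  apply: contrapT => J1; apply: (Imax J); last first.
    split=> [y z [c yc] [d zd]|a y [c yc]|//].
      exists (c + d); case: yc zd => [Iy|->] [Iz|->].
      - by left; have -> : y + z - (c + d) * x = y - c * x + (z - d * x);
          [ring | exact: ID].
      - by left; have -> : y + d * x - (c + d) * x = y - c * x; [ring|].
      - by left; have -> : c * x + z - (c + d) * x = z - d * x; [ring|].
      by right; rewrite mulrDl.
    exists (a * c); case: yc => [Iy|->]; last by right; rewrite mulrA.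
    by left; rewrite -mulrA -mulrBr; exact: IM.
  split=> [z Iz|JI]; first by exists 0; left; rewrite mul0r subr0.
  by apply/Ix/JI; exists 1; right; rewrite mul1r.
have I0 : I 0.
  apply: contrapT => /adjoin[c]; rewrite mulr0 subr0.
  by case=> [/I1|/B1].
exists I; split=> // x /adjoin[c [Ic|cx]]; exists c; last by rewrite -cx subrr.
by rewrite -opprB -mulN1r; exact: IM.
Qed.

Lemma polynomial_algebra_ext (A P C : comPzRingType) (n : nat)
    (c : {rmorphism A -> P}) (x : 'I_n -> P) (h h' : {rmorphism P -> C}) :
  is_polynomial_algebra c x ->
  (forall a, h (c a) = h' (c a)) -> (forall i, h (x i) = h' (x i)) -> h =1 h'.
Proof.
move=> P_poly hc hx; have [h0 _ uniq] := P_poly C (h' \o c) (h' \o x).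
by move=> p; rewrite (uniq h) // (uniq h').
Qed.

Section FiniteType.
Variables (A B : comPzRingType) (f : {rmorphism A -> B}).
Variables (n : nat) (P : comPzRingType) (c : {rmorphism A -> P}) (x : 'I_n -> P).
Variable (q : {rmorphism P -> B}).
Hypothesis P_poly : is_polynomial_algebra c x.
Hypothesis q_c : forall a, q (c a) = f a.
Hypothesis q_surj : forall b, exists t, q t = b.

(** Modulo the ideal of the x_i - a_i, both the projection of P and evaluation
    at a send x_i to a_i; by the universal property they agree. *)
Lemma taylor_expansion (a : 'I_n -> A) (b : B) :
  exists a0 (d : 'I_n -> B), b = f a0 + \sum_i d i * (q (x i) - f (a i)).
Proof.
pose J z := exists d : 'I_n -> B, z = \sum_i d i * (q (x i) - f (a i)).
have J_ideal : is_ideal J.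
  split=> [|_ _ [d ->] [d' ->]|u _ [d ->]].
  - by exists (fun=> 0); rewrite big1 // => i _; rewrite mul0r.
  - exists (fun i => d i + d' i); rewrite -big_split.
    by apply: eq_bigr => i _; rewrite mulrDl.
  by exists (fun i => u * d i); rewrite mulr_sumr; apply: eq_bigr => i _; rewrite mulrA.
have [Q [rho [_ rho_ker]]] := quotient_ring J_ideal.
have [h [hc hx] _] := P_poly idfun a.
have rhoE : rho \o q =1 rho \o (f \o h).
  apply: (polynomial_algebra_ext P_poly) => [a0|i] /=; first by rewrite q_c hc.
  rewrite hx; apply/eqP; rewrite -subr_eq0 -rmorphB; apply/eqP/rho_ker.
  exists (fun j => (j == i)%:R); rewrite (bigD1 i) //= eqxx mul1r big1 ?addr0 //.
  by move=> j /negbTE ->; rewrite mul0r.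
have [t <-] := q_surj b; exists (h t).
have /rho_ker[d dE] : rho (q t - f (h t)) = 0.
  by rewrite rmorphB -[rho (q t)]/((rho \o q) t) rhoE subrr.
by exists d; rewrite -dE addrC subrK.
Qed.

(** Derivations on the tower over the generators of L that kill the kernel of
    ev are derivations of B into L over A, which vanish. So L = K by
    [tower_without_derivation]. *)
Lemma unramified_point (K : fieldType) (p : {rmorphism A -> K}) :
  separably_closed K -> nilpotent_extension p -> unramified f -> (1 : B) <> 0 ->
  exists phi : {rmorphism B -> K}, forall a, phi (f a) = p a.
Proof.
move=> K_sc [p_surj p_ker] f_unr /maximal_ideal[I [I_ideal I1 I_max]].
have [L [pi [pi_surj _]]] := quotient_field I_ideal I1 I_max.
have [s sK] := choice p_surj.
have piE a a' : p a = p a' -> pi (f a) = pi (f a').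
  move=> aa'; apply/eqP; rewrite -subr_eq0 -!rmorphB.
  have /p_ker[m am] : p (a - a') = 0 by rewrite rmorphB aa' subrr.
  have /eqP : pi (f (a - a')) ^+ m = 0 by rewrite -!rmorphXn am !rmorph0.
  by rewrite expf_eq0 => /andP[].
pose iota0 y := pi (f (s y)).
have iotaB : zmod_morphism iota0.
  by move=> y z; rewrite /iota0 -!rmorphB; apply: piE; rewrite rmorphB !sK.
have iotaM : monoid_morphism iota0.
  split=> [|y z]; rewrite /iota0.
    by rewrite -(rmorph1 pi) -(rmorph1 f); apply: piE; rewrite sK rmorph1.
  by rewrite -!rmorphM; apply: piE; rewrite rmorphM !sK.
pose iota : {rmorphism K -> L} := HB.pack iota0
  (GRing.isZmodMorphism.Build _ _ iota0 iotaB)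
  (GRing.isMonoidMorphism.Build _ _ iota0 iotaM).
have iotaE a : iota (p a) = pi (f a) by apply: piE; rewrite sK.
have [R [k [ev [ev_k ev_x R_noder]]]] :=
  tower_without_derivation iota [seq pi (q (x i)) | i <- enum 'I_n] K_sc.
have /choice[y yE] (i : 'I_n) : exists r, ev r = pi (q (x i)).
  by apply/ev_x/map_f; rewrite mem_enum.
have [h [hc hx] _] := P_poly (k \o p) y.
have ev_h : ev \o h =1 pi \o q.
  apply: (polynomial_algebra_ext P_poly) => [a|i] /=; last by rewrite hx yE.
  by rewrite hc q_c /= ev_k iotaE.
have /choice[rep repE] (b : B) : exists r, ev r = pi b.
  by have [t <-] := q_surj b; exists (h t); exact: ev_h.
have iota_surj : forall r, exists a, ev r = iota a.
  apply: R_noder => D [DD DM] Dk D_ker r.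
  have D0 : D 0 = 0 by apply: D_ker; rewrite rmorph0.
  have DE u v : ev u = ev v -> D u = D v.
    move=> uv; have D_uv : D (u - v) = 0 by apply: D_ker; rewrite rmorphB uv subrr.
    by rewrite -[u](subrK v) DD D_uv add0r.
  have [b bE] := pi_surj (ev r).
  rewrite (DE r (rep b)) ?repE //.
  apply: (unramified_derivation0 (M := restr_scalars pi) (D := D \o rep) f_unr).
  split=> [u v|u v|a] /=.
  - by rewrite -DD; apply: DE; rewrite rmorphD !repE rmorphD.
  - rewrite -[RHS]/(pi u * D (rep v) + pi v * D (rep u)) -!repE -DM.
    by apply: DE; rewrite rmorphM !repE rmorphM.
  by rewrite (DE (rep (f a)) (k (p a))) ?Dk // repE ev_k iotaE.
have /choice[phi phiE] (b : B) : exists y, iota y = pi b.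
  by have [a aE] := iota_surj (rep b); exists a; rewrite -aE repE.
have phiB : zmod_morphism phi.
  by move=> u v; apply: (fmorph_inj iota); rewrite rmorphB !phiE rmorphB.
have phiM : monoid_morphism phi.
  split=> [|u v]; apply: (fmorph_inj iota); first by rewrite phiE !rmorph1.
  by rewrite rmorphM !phiE rmorphM.
pose phi' : {rmorphism B -> K} := HB.pack phi
  (GRing.isZmodMorphism.Build _ _ phi phiB)
  (GRing.isMonoidMorphism.Build _ _ phi phiM).
by exists phi' => a; apply: (fmorph_inj iota); rewrite phiE iotaE.
Qed.

End FiniteType.

(** * Extended ideals, Nakayama and annihilators under flat maps *)

Lemma factor_linear (A : comPzRingType) (V Q N : lmodType A) (pi : {linear V -> Q})
    (g : {linear V -> N}) :
  (forall y, exists x, pi x = y) -> (forall x, pi x = 0 -> g x = 0) ->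
  exists h : {linear Q -> N}, forall x, h (pi x) = g x.
Proof.
move=> /choice[s sK] ker_sub; pose h0 := g \o s.
have hE x : h0 (pi x) = g x.
  apply/eqP; rewrite -subr_eq0 -raddfB; apply/eqP/ker_sub.
  by rewrite raddfB /= sK subrr.
have h_lin : linear h0.
  by move=> a x y; rewrite -{1}(sK x) -{1}(sK y) -linearP hE linearP.
pose h : {linear Q -> N} := HB.pack h0 (GRing.isLinear.Build _ _ _ _ h0 h_lin).
by exists h.
Qed.

Section ExtendedIdeal.
Variables (A B : comPzRingType) (f : {rmorphism A -> B}).

(** Membership in W + f(s_1) e B + f(s_2) e B + ..., by recursion on the list so
    that the nilpotents can be removed one at a time. *)
Fixpoint in_sum (e : B) (W : B -> Prop) (s : seq A) (b : B) : Prop :=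
  if s is a :: s' then exists c, in_sum e W s' (b - f a * (e * c)) else W b.

Definition submodule_pred (W : B -> Prop) :=
  [/\ W 0, forall x y, W x -> W y -> W (x + y) & forall a x, W x -> W (f a * x)].

Lemma zero_submodule : submodule_pred (fun b => b = 0).
Proof. by split=> [|x y -> ->|a x ->]; rewrite ?addr0 ?mulr0. Qed.

Lemma in_sum_submodule e W s : submodule_pred W -> submodule_pred (in_sum e W s).
Proof.
move=> W_sub; elim: s => [|a s [IH0 IHD IHM]] //=; split=> [|x y [c xc] [d yd]|b x [c xc]].
- by exists 0; rewrite !mulr0 subr0.
- exists (c + d); have -> : x + y - f a * (e * (c + d)) =
    (x - f a * (e * c)) + (y - f a * (e * d)) by ring.
  exact: IHD.
exists (f b * c); have -> : f b * x - f a * (e * (f b * c)) =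
  f b * (x - f a * (e * c)) by ring.
exact: IHM.
Qed.

Lemma sub_in_sum e (W W' : B -> Prop) s :
  (forall b, W b -> W' b) -> forall b, in_sum e W s b -> in_sum e W' s b.
Proof. by move=> WW'; elim: s => [//|a s IHs] b [c bc]; exists c; exact: IHs. Qed.

Lemma mem_in_sum e W s b : W b -> in_sum e W s b.
Proof. by elim: s => [//|a s IHs] Wb /=; exists 0; rewrite !mulr0 subr0; exact: IHs. Qed.

(** Modulo W' = W + f(s') e B, where s' is the tail of the list, each element
    e b is in f(a) e B; iterating, it is in f(a)^m e B for all m, hence in W'. *)
Lemma nilpotent_nakayama e W s :
  submodule_pred W -> (forall a, a \in s -> nilpotent a) ->
  (forall b, in_sum e W s (e * b)) -> forall b, W (e * b).
Proof.
move=> W_sub; elim: s => [//|a s IHs] s_nil eW.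
apply: IHs => [c cs|b]; first by apply: s_nil; rewrite inE cs orbT.
have [W'0 W'D W'M] := in_sum_submodule e s W_sub.
have [m am] : nilpotent a by apply: s_nil; rewrite inE eqxx.
suff /(_ m)[c] : forall m, exists c, in_sum e W s (e * b - f a ^+ m * (e * c)).
  by rewrite -rmorphXn am rmorph0 mul0r subr0.
elim=> [|l [c bc]]; first by exists b; rewrite expr0 mul1r subrr.
have [d cd] := eW c; exists d.
have -> : e * b - f a ^+ l.+1 * (e * d) =
  (e * b - f a ^+ l * (e * c)) + f a ^+ l * (e * c - f a * (e * d)).
  by rewrite exprS; ring.
by apply: W'D => //; rewrite -rmorphXn; exact: W'M.
Qed.

Definition in_span := in_sum 1 (fun b => b = 0).

Lemma in_span0 s : in_span s 0.
Proof. exact: mem_in_sum. Qed.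

Lemma in_spanD s b b' : in_span s b -> in_span s b' -> in_span s (b + b').
Proof. by have [_ D _] := in_sum_submodule 1 s zero_submodule; exact: D. Qed.

Lemma in_spanM s d b : in_span s b -> in_span s (d * b).
Proof.
elim: s d b => [|a s IHs] d b /= => [->|[c bc]]; first exact: mulr0.
exists (d * c); have -> : d * b - f a * (1 * (d * c)) = d * (b - f a * (1 * c)) by ring.
exact: IHs.
Qed.

Lemma in_span_cat s t b b' : in_span s b -> in_span t b' -> in_span (s ++ t) (b + b').
Proof.
elim: s b => [|a s IHs] b /=; first by move=> ->; rewrite add0r.
by move=> [c bc] tb'; exists c; rewrite addrAC; exact: IHs.
Qed.

Lemma in_span_in_sum e s b : in_span s b -> in_sum e (fun b => b = 0) s (e * b).
Proof.
elim: s b => [|a s IHs] b /= => [->|[c /IHs bc]]; first exact: mulr0.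
by exists c; move: bc; rewrite mul1r mulrBr mulrCA.
Qed.

Definition extended_ideal (S : A -> Prop) (b : B) :=
  exists2 s : seq A, forall a, a \in s -> S a & in_span s b.

Lemma extended_ideal_gen (S : A -> Prop) a : S a -> extended_ideal S (f a).
Proof.
move=> Sa; exists [:: a] => [c|]; first by rewrite inE => /eqP ->.
by exists 1; rewrite !mulr1 subrr.
Qed.

Lemma extended_ideal_ideal S : is_ideal (extended_ideal S).
Proof.
split=> [|x y [s sS xs] [t tS yt]|d x [s sS xs]].
- by exists [::].
- exists (s ++ t) => [a|]; last exact: in_span_cat.
  by rewrite mem_cat => /orP[/sS|/tS].
by exists s => //; exact: in_spanM.
Qed.

Lemma extended_ideal_sub (S : A -> Prop) (I : B -> Prop) :
  is_ideal I -> (forall a, S a -> I (f a)) -> forall b, extended_ideal S b -> I b.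
Proof.
move=> [I0 ID IM] SI b [s sS]; elim: s b sS => [|a s IHs] b sS /=; first by move=> ->.
move=> [c bc]; rewrite -(subrK (f a * (1 * c)) b); apply: ID.
  by apply: IHs bc => a' a's; apply: sS; rewrite inE a's orbT.
by rewrite mul1r mulrC; apply/IM/SI/sS; rewrite inE eqxx.
Qed.

(** Nakayama needs a finite list of nilpotents valid for all generators. *)
Lemma extended_ideal_seq S (z : seq B) :
  (forall b, b \in z -> extended_ideal S b) ->
  exists2 s : seq A, forall a, a \in s -> S a & forall b, b \in z -> in_span s b.
Proof.
elim: z => [|b z IHz] zS; first by exists [::].
have [s sS zs] := IHz (fun b' b'z => zS b' (mem_behead (s := b :: z) b'z)).
have [t tS bt] := zS b (mem_head b z).
exists (s ++ t) => [a|b']; first by rewrite mem_cat => /orP[/sS|/tS].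
rewrite inE => /predU1P[->|/zs b's].
  by rewrite -[b]add0r; apply: in_span_cat => //; exact: in_span0.
by rewrite -[b']addr0; apply: in_span_cat => //; exact: in_span0.
Qed.

(** A/S (x) B = B/SB. The trivial S gives A (x) B = B as well. *)
Lemma tensor_quotient (S : A -> Prop) (M T : lmodType A) (rho : {linear A^o -> M})
    (tau : {linear restr_scalars f -> T}) (sec : M -> A) :
  cancel sec rho -> (forall x, rho x = 0 <-> S x) ->
  (forall y, exists x, tau x = y) ->
  (forall x, tau x = 0 <-> extended_ideal S x) ->
  is_tensor (fun (m : M) (b : restr_scalars f) =>
    tau (f (sec m) * (b : B) : restr_scalars f)).
Proof.
move=> secK rho_ker tau_surj tau_ker.
have [_ _ SBM] := extended_ideal_ideal S.
pose t (m : M) (b : restr_scalars f) := tau (f (sec m) * (b : B) : restr_scalars f).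
have tE x b : t (rho x) b = tau (f x * (b : B) : restr_scalars f).
  apply/eqP; rewrite -subr_eq0 -raddfB; apply/eqP/tau_ker.
  rewrite -[_ - _]/(f (sec (rho x)) * (b : B) - f x * (b : B)) -mulrBl -rmorphB mulrC.
  apply/SBM/extended_ideal_gen/rho_ker.
  by rewrite raddfB /= secK subrr.
have t_bil : is_bilinear t.
  split=> [b|m] a x y.
    rewrite -{1}(secK x) -{1}(secK y) -linearP /= !tE -linearP /=; congr (tau _).
    by rewrite /= rmorphD rmorphM mulrDl -mulrA.
  rewrite /t -linearP; congr (tau _).
  by rewrite /= -[a *: x]/(f a * (x : B)) -[RHS]/(f a * (f (sec m) * (x : B)) + _) mulrDr mulrCA.
split=> // N beta beta_bil.
have beta_ker (b : restr_scalars f) : tau b = 0 -> beta (rho 1) b = 0.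
  move=> /tau_ker Sb; pose I (x : B) := forall d, beta (rho 1) (d * x : B) = 0.
  suff /(_ 1) : I b by rewrite mul1r.
  move: b Sb; apply: extended_ideal_sub.
    split=> [d|x y Ix Iy d|c x Ix d]; last by rewrite mulrA.
      by rewrite mulr0 (bilin0r beta_bil).
    by rewrite mulrDr (bilinDr beta_bil) Ix Iy addr0.
  move=> c /rho_ker c0 d; rewrite mulrC -[f c * d]/(c *: (d : restr_scalars f)).
  rewrite (bilinZr beta_bil) -(bilinZl beta_bil) -linearZ /=.
  by rewrite -[c *: _]/(c * 1) mulr1 c0 (bilin0l beta_bil).
have beta1_lin : linear (beta (rho 1)) := beta_bil.2 (rho 1).
pose beta1 : {linear restr_scalars f -> N} :=
  HB.pack (beta (rho 1)) (GRing.isLinear.Build _ _ _ _ (beta (rho 1)) beta1_lin).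
have [g gE] := factor_linear (g := beta1) tau_surj beta_ker.
exists g => [m b|g' g'E z].
  rewrite gE /= -[f (sec m) * _]/(sec m *: b) (bilinZr beta_bil) -(bilinZl beta_bil).
  by rewrite -linearZ /= -[_ *: _]/(sec m * 1) mulr1 secK.
have [b <-] := tau_surj z; rewrite gE /= -g'E -/(t _ _) tE rmorph1.
by rewrite mul1r.
Qed.

(** Multiplication by a embeds A/Ann(a) into A; after tensoring with B it is
    the map B/Ann(a)B -> B, whose injectivity is the claim. *)
Lemma flat_annihilator (a : A) (b : B) :
  flat f -> f a * b = 0 -> extended_ideal (fun c => a * c = 0) b.
Proof.
move=> f_flat ab0; pose S c := a * c = 0.
have [M [rho [rho_surj rho_ker]]] : exists (M : lmodType A) (rho : {linear A^o -> M}),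
    (forall y, exists x, rho x = y) /\ (forall x, rho x = 0 <-> S x).
  apply: quotient_module => [|x y ax ay|c x ax]; rewrite /S ?mulr0 //.
    by rewrite mulrDr ax ay addr0.
  by rewrite mulrCA ax mulr0.
have [SB0 SBD SBM] := extended_ideal_ideal S.
have [T [tau [tau_surj tau_ker]]] : exists (T : lmodType A)
    (tau : {linear restr_scalars f -> T}),
    (forall y, exists x, tau x = y) /\ (forall x, tau x = 0 <-> extended_ideal S x).
  by apply: quotient_module => // c x; exact: SBM.
have [sec secK] := choice rho_surj.
have t_tens := tensor_quotient secK rho_ker tau_surj tau_ker.
have zero_ker (x : B) : x = 0 <-> extended_ideal (fun c => c = 0) x.
  split=> [->|]; first by have [] := extended_ideal_ideal (fun c => c = 0).
  apply: (extended_ideal_sub (I := fun y => y = 0)) => [|_ ->]; last exact: rmorph0.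
  by split=> [|y z -> ->|c y ->]; rewrite ?addr0 ?mulr0.
have t'_tens : is_tensor (fun (x : A^o) (y : restr_scalars f) =>
    f x * (y : B) : restr_scalars f).
  apply: (@tensor_quotient (fun c => c = 0) A^o (restr_scalars f) idfun idfun id) => //.
  by move=> y; exists y.
have mul_lin : linear (fun x : A^o => a * x : A^o).
  by move=> c x y; rewrite mulrDr -[c *: x]/(c * x) mulrCA.
pose mul : {linear A^o -> A^o} := HB.pack (fun x : A^o => a * x : A^o)
  (GRing.isLinear.Build _ _ _ _ _ mul_lin).
have mulf_lin : linear (fun y : restr_scalars f => f a * (y : B) : restr_scalars f).
  by move=> c x y; rewrite -[c *: x + y]/(f c * (x : B) + y) mulrDr mulrCA.
pose mulf : {linear restr_scalars f -> restr_scalars f} :=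
  HB.pack (fun y : restr_scalars f => f a * (y : B) : restr_scalars f)
  (GRing.isLinear.Build _ _ _ _ _ mulf_lin).
have [u uE] : exists u : {linear M -> A^o}, forall x, u (rho x) = mul x.
  by apply: factor_linear => // x /rho_ker.
have [v vE] : exists v : {linear T -> restr_scalars f}, forall x, v (tau x) = mulf x.
  apply: factor_linear => // x /tau_ker.
  apply: (extended_ideal_sub (I := fun x : B => f a * x = 0)) => [|c ac].
    split=> [|y z ay az|c y ay]; rewrite ?mulr0 //.
      by rewrite mulrDr ay az addr0.
    by rewrite mulrCA ay mulr0.
  by rewrite -rmorphM ac rmorph0.
have u_inj : injective u.
  apply: raddf_inj => m; have [x <-] := rho_surj m.
  by move=> ux0; apply/rho_ker; rewrite /S -[a * x]/(mul x) -uE.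
have uv (m : M) (y : restr_scalars f) :
    v (tau (f (sec m) * (y : B) : restr_scalars f)) = f (u m) * (y : B).
  by rewrite vE -[in RHS](secK m) uE /= rmorphM mulrA.
have v_inj := f_flat M A^o u u_inj _ _ _ _ t_tens t'_tens v uv.
by apply/tau_ker/v_inj; rewrite vE raddf0.
Qed.

End ExtendedIdeal.

(** * Retractions of etale algebras over nilpotent extensions *)

(** Nakayama by the adjugate of 1 - m, where the entries of m lie in the kernel
    of phi, so that phi maps the determinant to 1. *)
Lemma determinant_trick (B : comPzRingType) (K : fieldType) (phi : {rmorphism B -> K})
    (I : B -> Prop) (n : nat) (y : 'I_n -> B) :
  is_ideal I ->
  (forall i, exists2 m : 'I_n -> B, forall j, phi (m j) = 0 &
     I (y i - \sum_j m j * y j)) ->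
  exists2 g, phi g = 1 & forall i, I (g * y i).
Proof.
move=> [I0 ID IM] y_mod.
have /choice[m mP] i : exists m : 'I_n -> B,
    (forall j, phi (m j) = 0) /\ I (y i - \sum_j m j * y j).
  by have [m m0 my] := y_mod i; exists m.
have m0 i := (mP i).1; have my i := (mP i).2.
pose N : 'M[B]_n := 1%:M - \matrix_(i, j) m i j.
exists (\det N) => [|i].
  rewrite -det_map_mx map_mxB map_mx1.
  suff -> : map_mx phi (\matrix_(i, j) m i j) = 0 by rewrite subr0 det1.
  by apply/matrixP => i j; rewrite !mxE m0.
pose Y : 'cV[B]_n := \col_i y i.
have -> : \det N * y i = (\adj N *m (N *m Y)) i 0.
  by rewrite mulmxA mul_adj_mx mul_scalar_mx !mxE.
have NY j : (N *m Y) j 0 = y j - \sum_k m j k * y k.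
  rewrite mulmxBl mul1mx !mxE; congr (_ - _); apply: eq_bigr => k _.
  by rewrite !mxE.
rewrite mxE; apply: (big_ind I) => // j _.
by rewrite NY; exact: IM.
Qed.

(** e = 1 - (1 - g^k)^k is divisible by g^k and 1 - e by (1 - g)^k. *)
Lemma idempotent_lift (B : comPzRingType) (g : B) :
  nilpotent (g * (1 - g)) ->
  exists e w w', [/\ e * (1 - e) = 0, e = g * w & 1 - e = (1 - g) * w'].
Proof.
(* A positive exponent, so that e and 1 - e are multiples of g and 1 - g. *)
move=> [k0 gk]; pose k := k0.+1.
have {}gk : g ^+ k * (1 - g) ^+ k = 0 by rewrite -exprMn exprS gk mulr0.
have geo (h : B) l : exists v, 1 - h ^+ l = (1 - h) * v.
  exists (\sum_(i < l) h ^+ i); apply: oppr_inj.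
  by rewrite -mulNr !opprB subrX1.
have [v vE] := geo g k; have [v' v'E] := geo (1 - g ^+ k) k.
pose e := 1 - (1 - g ^+ k) ^+ k.
have eE : e = g ^+ k * v' by rewrite /e v'E; congr (_ * _); ring.
have e1E : 1 - e = (1 - g) ^+ k * v ^+ k.
  by rewrite -exprMn -vE /e; ring.
exists e, (g ^+ k0 * v'), ((1 - g) ^+ k0 * v ^+ k); split.
- by rewrite e1E eE mulrACA gk mul0r.
- by rewrite eE exprS mulrA.
by rewrite e1E [X in X * _]exprS mulrA.
Qed.

Section Retraction.
Variables (A B : comPzRingType) (f : {rmorphism A -> B}).
Variables (K : fieldType) (p : {rmorphism A -> K}) (phi : {rmorphism B -> K}).
Hypothesis p_nil : nilpotent_extension p.
Hypothesis phi_f : forall a, phi (f a) = p a.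

(** Under these hypotheses e B is free on e: if a e = 0 with a <> 0, then e lies
    in Ann(a)B, whose elements are nilpotent because Ann(a) contains no unit,
    and e would be nilpotent although phi e = 1. The retraction sends b to the
    coordinate of e b. *)
Lemma retraction_of_rank_one (e : B) :
  flat f -> phi e = 1 -> (forall b, exists a, e * b = f a * e) ->
  exists g : {rmorphism B -> A}, cancel f g.
Proof.
move=> f_flat phi_e /choice[g gE]; have [p_surj p_ker] := p_nil.
have nil_ideal := nilpotent_ideal B.
have e_inj0 a : f a * e = 0 -> a = 0.
  move=> /(flat_annihilator f_flat) ann_e; apply: contrapT => a_n0.
  have [k ek] : nilpotent e.
    apply: (extended_ideal_sub nil_ideal _ ann_e) => c ac0.
    have [/p_ker[k ck]|/eqP pc] := pselect (p c = 0).
      by exists k; rewrite -rmorphXn ck rmorph0.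
    case: a_n0; have [d dE] := p_surj (p c)^-1.
    have /p_ker/nilpotent_unit[u uE] : p (1 - c * d) = 0.
      by rewrite rmorphB rmorphM dE rmorph1 divff // subrr.
    rewrite -[a]mulr1 -uE; have -> : a * (u * (1 - (1 - c * d))) = a * c * (u * d) by ring.
    by rewrite ac0 mul0r.
  have /eqP := oner_neq0 K; apply.
  by rewrite -(expr1n K k) -phi_e -rmorphXn ek rmorph0.
have e_inj a a' : f a * e = f a' * e -> a = a'.
  move=> aa'; apply/eqP; rewrite -subr_eq0; apply/eqP/e_inj0.
  by rewrite rmorphB mulrBl aa' subrr.
have gB : zmod_morphism g.
  by move=> x y; apply: e_inj; rewrite -gE rmorphB mulrBl -!gE mulrBr.
have gM : monoid_morphism g.
  split=> [|x y]; apply: e_inj; first by rewrite -gE mulr1 rmorph1 mul1r.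
  by rewrite -gE rmorphM -mulrA -gE [in RHS]mulrA -gE mulrA.
pose g' : {rmorphism B -> A} := HB.pack g
  (GRing.isZmodMorphism.Build _ _ g gB) (GRing.isMonoidMorphism.Build _ _ g gM).
by exists g' => a; apply: e_inj; rewrite -gE mulrC.
Qed.

(** NB is the ideal extended from the kernel of A -> K, and the y i generate the
    kernel of phi modulo NB. The ideal J is NB + (ker phi)^2. *)
Lemma etale_point_retraction : Etf f -> exists g : {rmorphism B -> A}, cancel f g.
Proof.
move=> [[f_flat f_unr] [n [P [c [x [P_poly [q [q_c q_surj _]]]]]]]].
have [p_surj p_ker] := p_nil; have /choice[s sK] := p_surj.
pose NB := extended_ideal f (fun a => p a = 0).
have NB_ideal : is_ideal NB by exact: extended_ideal_ideal.
have [NB0 NBD NBM] := NB_ideal.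
have NBf a : p a = 0 -> NB (f a) by exact: extended_ideal_gen.
pose sg b := f (s (phi b)).
have sgE b : phi (sg b) = phi b by rewrite /sg phi_f sK.
pose a i := s (phi (q (x i))).
pose y i := q (x i) - f (a i).
have y0 i : phi (y i) = 0 by rewrite rmorphB sgE subrr.
have taylor b : exists a0 d, b = f a0 + \sum_i d i * y i.
  exact: (taylor_expansion P_poly q_c q_surj a b).
pose J b := exists2 m : 'I_n -> B, forall j, phi (m j) = 0 & NB (b - \sum_j m j * y j).
have [J0 JD JM] : is_ideal J.
  split=> [|b b' [m m0 mb] [m' m'0 mb']|d b [m m0 mb]].
  - exists (fun=> 0) => [j|]; first exact: rmorph0.
    by rewrite big1 ?subr0 // => j _; rewrite mul0r.
  - exists (fun j => m j + m' j) => [j|]; first by rewrite rmorphD m0 m'0 addr0.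
    under eq_bigr do rewrite mulrDl.
    by rewrite big_split opprD addrACA; exact: NBD.
  exists (fun j => d * m j) => [j|]; first by rewrite rmorphM m0 mulr0.
  under eq_bigr do rewrite -mulrA.
  by rewrite -mulr_sumr -mulrBr; exact: NBM.
have J_NB b : NB b -> J b.
  move=> Nb; exists (fun=> 0) => [j|]; first exact: rmorph0.
  by rewrite big1 ?subr0 // => j _; rewrite mul0r.
have ker_expand b : phi b = 0 -> exists a0 d, p a0 = 0 /\ b = f a0 + \sum_i d i * y i.
  move=> b0; have [a0 [d bE]] := taylor b; exists a0, d; split=> //.
  rewrite -phi_f -b0 bE rmorphD rmorph_sum big1 ?addr0 // => i _.
  by rewrite rmorphM y0 mulr0.
have J_sq b b' : phi b = 0 -> phi b' = 0 -> J (b * b').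
  move=> /ker_expand[a0 [d [pa0 ->]]] b'0; rewrite mulrDl; apply: JD.
    by apply: J_NB; rewrite mulrC; apply/NBM/NBf.
  exists (fun j => b' * d j) => [j|]; first by rewrite rmorphM b'0 mul0r.
  by rewrite mulrC mulr_sumr; under eq_bigr do rewrite mulrA; rewrite subrr.
(* b |-> b - sg b is a derivation modulo J: its Leibniz defect is
   (u - sg u) (v - sg v) up to an element of NB. *)
have J_ker b : J (b - sg b).
  have [Q [rho [_ rho_ker]]] := @quotient_module B B^o J J0 JD JM.
  apply/rho_ker; apply: (unramified_derivation0 (f := f) (M := Q)
    (D := fun b => rho (b - sg b : B^o))) => //.
  have rhoE (u v : B) : J (u - v) -> rho (u : B^o) = rho (v : B^o).
    by move=> Juv; apply/eqP; rewrite -subr_eq0 -raddfB; apply/eqP/rho_ker.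
  have J_sg a0 b0 : p a0 = phi b0 -> J (f a0 - sg b0).
    by move=> ab; apply: J_NB; rewrite /sg -rmorphB; apply: NBf; rewrite rmorphB sK ab subrr.
  split=> [u v|u v|a0].
  - rewrite -raddfD; apply: rhoE => /=.
    have -> : u + v - sg (u + v) - (u - sg u + (v - sg v)) =
      f (s (phi u) + s (phi v)) - sg (u + v) by rewrite /sg; ring.
    by apply: J_sg; rewrite !rmorphD !sK.
  - rewrite -!linearZ -raddfD; apply: rhoE => /=.
    rewrite -[u *: _]/(u * (v - sg v)) -[v *: _]/(v * (u - sg u)).
    have -> : u * v - sg (u * v) - (u * (v - sg v) + v * (u - sg u)) =
      (-1) * ((u - sg u) * (v - sg v)) + (f (s (phi u) * s (phi v)) - sg (u * v)).
      by rewrite /sg; ring.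
    apply: JD; first by apply/JM/J_sq; rewrite rmorphB sgE subrr.
    by apply: J_sg; rewrite !rmorphM !sK.
  by rewrite -(raddf0 rho); apply: rhoE; rewrite subr0; apply: J_sg; rewrite phi_f.
have [g phi_g gy] : exists2 g, phi g = 1 & forall i, NB (g * y i).
  by apply: determinant_trick => // i; exact: (J_ker (q (x i))).
have g_ker b : phi b = 0 -> NB (g * b).
  move=> /ker_expand[a0 [d [pa0 ->]]]; rewrite mulrDr; apply/NBD; first exact/NBM/NBf.
  rewrite mulr_sumr; apply: (big_ind NB NB0 NBD) => i _.
  by rewrite mulrCA; exact: NBM.
have NB_nil b : NB b -> nilpotent b.
  apply: (extended_ideal_sub (nilpotent_ideal B)) => a0 /p_ker[k ak].
  by exists k; rewrite -rmorphXn ak rmorph0.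
have [|e [w [w' [ee eg e1g]]]] := @idempotent_lift B g.
  by apply/NB_nil/g_ker; rewrite rmorphB rmorph1 phi_g subrr.
have phi_e : phi e = 1.
  apply/eqP; rewrite -subr_eq0 -opprB oppr_eq0 -(rmorph1 phi) -rmorphB e1g rmorphM.
  by rewrite rmorphB rmorph1 phi_g subrr mul0r.
apply: (retraction_of_rank_one f_flat phi_e) => b.
have [t t_nil ty] : exists2 t : seq A, forall a0, a0 \in t -> p a0 = 0 &
    forall b, b \in [seq e * y i | i <- enum 'I_n] -> in_span f t b.
  apply: extended_ideal_seq => _ /mapP[i _ ->].
  by rewrite eg mulrAC mulrC; exact: NBM.
pose W b := exists a0, b = f a0 * e.
have W_sub : submodule_pred f W.
  split=> [|_ _ [a1 ->] [a2 ->]|a0 _ [a1 ->]].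
  - by exists 0; rewrite rmorph0 mul0r.
  - by exists (a1 + a2); rewrite rmorphD mulrDl.
  by exists (a0 * a1); rewrite rmorphM mulrA.
move: b; apply: (nilpotent_nakayama W_sub (s := t)) => [a0 /t_nil/p_ker //|b].
have [a0 [d bE]] := taylor b.
have [_ WD _] := in_sum_submodule e t W_sub.
have bt : in_span f t (e * (\sum_i d i * y i)).
  rewrite mulr_sumr; apply: (big_ind (in_span f t)) => [|u v|i _]; first exact: in_span0.
    exact: in_spanD.
  by rewrite mulrCA; apply/in_spanM/ty/map_f; rewrite mem_enum.
rewrite bE mulrDr; apply: WD; first by apply: mem_in_sum; exists a0; exact: mulrC.
have -> : e * (\sum_i d i * y i) = e * (e * (\sum_i d i * y i)).
  by apply/eqP; rewrite -subr_eq0 -[X in X - _]mul1r -mulrBl mulrA mulrC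
    [(1 - e) * e]mulrC ee mulr0.
apply: (sub_in_sum (W := fun b => b = 0)); last exact: in_span_in_sum.
by move=> _ ->; exists 0; rewrite rmorph0 mul0r.
Qed.

End Retraction.

Theorem proposition68 (A : comPzRingType) :
  is_point A <->
  exists (K : fieldType) (p : {rmorphism A -> K}),
    separably_closed K /\ nilpotent_extension p.
Proof.
split=> [|[K [p [K_sc p_nil]]]]; first exact: point_is_nilpotent_extension.
split=> [A1|B f f_et B1].
  by have /eqP := oner_neq0 K; apply; rewrite -(rmorph1 p) A1 rmorph0.
have [[_ f_unr] [n [P [c [x [P_poly [q [q_c q_surj _]]]]]]]] := f_et.
have [phi phi_f] := unramified_point P_poly q_c q_surj K_sc p_nil f_unr B1.
exact: etale_point_retraction p_nil phi_f f_et.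
Qed.
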